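(* Let $G$ be a finite group, let $U$ be a projective unitary representation of $G$ on a finite-dimensional Hilbert space $\mathcal H$, and let $|\psi\rangle,|\phi\rangle\in\mathcal H$ be arbitrary pure states satisfying $G_{\psi,0}\subset G_{\phi,0}$. Then \[ R_{\mathrm{ap}}(\psi\to\phi)=\begin{cases}\infty & \text{if } \mathrm{Sym}_G(\psi)\subset\mathrm{Sym}_G(\phi),\\ 0 & \text{otherwise}.\end{cases} \]
   Context: A projective unitary representation $U$ of $G$ assigns unitaries $U(g)$ with $U(g)U(g')=e^{i\omega(g,g')}U(gg')$; write $\mathcal U_g(X)=U(g)XU(g)^\dagger$, and on $\mathcal H^{\otimes n}$ use $g\mapsto U(g)^{\otimes n}$. A CPTP map $\Lambda$ is covariant (w.r.t. input representation $\mathcal U_G$ and output representation $\mathcal U'_G$) if $\mathcal U'_g\circ\Lambda=\Lambda\circ\mathcal U_g$ for all $g\in G$. For a pure state, $\chi_\psi(g)=\langle\psi|U(g)|\psi\rangle$, $G_{\psi,0}:=\{g\in G:|\chi_\psi(g)|=1\}$, and $\mathrm{Sym}_G(\psi):=\{g\in G:U(g)\psi U(g)^\dagger=\psi\}$ with $\psi=|\psi\rangle\langle\psi|$. The approximate asymptotic conversion rate is $R_{\mathrm{ap}}(\psi\to\phi):=\sup\{r\ge0:$ there is a sequence $\epsilon_N\to0$ such that for every $N$ there is a covariant CPTP map $\Lambda_N$ (w.r.t. $U^{\otimes N}$ and $U^{\otimes\lfloor rN\rfloor}$) with $T(\phi^{\otimes\lfloor rN\rfloor},\Lambda_N(\psi^{\otimes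 N}))\le\epsilon_N\}$, where $T(\rho,\sigma)=\frac12\|\rho-\sigma\|_1$. *)

(* Defs.v *)
From HB Require Import structures.
From mathcomp Require Import all_boot all_order all_algebra all_fingroup.
From mathcomp Require Import all_classical all_reals all_analysis.
From mathcomp Require Import complex mxtens.

Set Implicit Arguments.
Unset Strict Implicit.
Unset Printing Implicit Defensive.

Import Order.TTheory GRing.Theory Num.Theory.
Local Open Scope ring_scope.
Local Open Scope classical_set_scope.
Import numFieldNormedType.Exports.

Section Quantum.
Variable R : realType.
Local Notation C := (R[i]).

Definition adjmx {m n} (A : 'M[C]_(m, n)) : 'M[C]_(n, m) :=
  (map_mx Num.conj A)^T.

Definition is_pure_state {d} (v : 'cV[C]_d) : Prop := (adjmx v *m v) 0 0 = 1.
Definition dens {d} (v : 'cV[C]_d) : 'M[C]_d := v *m adjmx v.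

Definition psd {n} (X : 'M[C]_n) : Prop :=
  forall v : 'cV[C]_n, 0 <= (adjmx v *m X *m v) 0 0.

Definition eigs {n} (A : 'M[C]_n) : seq C :=
  sval (closed_field_poly_normal (char_poly A)).

Definition trnorm {n} (A : 'M[C]_n) : C :=
  \sum_(z <- eigs (adjmx A *m A)) sqrtC z.

Definition tdist {n} (X Y : 'M[C]_n) : C := trnorm (X - Y) / 2%:R.

Definition is_linear_map {m n} (Phi : 'M[C]_m -> 'M[C]_n) : Prop :=
  forall (a : C) X Y, Phi (a *: X + Y) = a *: Phi X + Phi Y.

(** (i,j) block of size m of a (k*m) x (k*m) matrix (index (i,a) <-> i*m+a) *)
Definition blk {k m} (X : 'M[C]_(k * m)) (i j : 'I_k) : 'M[C]_m :=
  \matrix_(a, b) X (mxtens_index (i, a)) (mxtens_index (j, b)).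

(** id_k (x) Phi *)
Definition ampl k {m n} (Phi : 'M[C]_m -> 'M[C]_n) (X : 'M[C]_(k * m))
  : 'M[C]_(k * n) :=
  \sum_(i < k) \sum_(j < k) (delta_mx i j *t Phi (blk X i j)).

Arguments ampl k {m n} Phi X.

Definition is_CP {m n} (Phi : 'M[C]_m -> 'M[C]_n) : Prop :=
  forall k (X : 'M[C]_(k * m)), psd X -> psd (ampl k Phi X).

Definition is_TP {m n} (Phi : 'M[C]_m -> 'M[C]_n) : Prop :=
  forall X, \tr (Phi X) = \tr X.

Definition is_CPTP {m n} (Phi : 'M[C]_m -> 'M[C]_n) : Prop :=
  is_linear_map Phi /\ is_CP Phi /\ is_TP Phi.

Variable gT : finGroupType.

Definition is_proj_unitary_rep {d} (U : gT -> 'M[C]_d) : Prop :=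
  (forall g, U g *m adjmx (U g) = 1%:M) /\
  (forall g h, exists c : C, `|c| = 1 /\ U g *m U h = c *: U (g * h)%g).

Definition is_covariant {d} (U : gT -> 'M[C]_d) (N M : nat)
  (Phi : 'M[C]_(d ^ N) -> 'M[C]_(d ^ M)) : Prop :=
  forall g X,
    Phi (U g ^t N *m X *m adjmx (U g ^t N)) =
    U g ^t M *m Phi X *m adjmx (U g ^t M).

Definition chi {d} (U : gT -> 'M[C]_d) (psi : 'cV[C]_d) (g : gT) : C :=
  (adjmx psi *m U g *m psi) 0 0.

Definition G0 {d} (U : gT -> 'M[C]_d) (psi : 'cV[C]_d) : set gT :=
  [set g | `|chi U psi g| = 1].

Definition SymG {d} (U : gT -> 'M[C]_d) (psi : 'cV[C]_d) : set gT :=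
  [set g | U g *m dens psi *m adjmx (U g) = dens psi].

Definition achievable_ap {d} (U : gT -> 'M[C]_d) (psi phi : 'cV[C]_d) (r : R)
  : Prop :=
  exists eps : nat -> R, eps @ \oo --> (0 : R) /\
    forall N : nat,
      exists Phi : 'M[C]_(d ^ N) -> 'M[C]_(d ^ Num.truncn (r * N%:R)),
        is_CPTP Phi /\ is_covariant U Phi /\
        tdist (dens phi ^t Num.truncn (r * N%:R)) (Phi (dens psi ^t N))
          <= (eps N)%:C%C.

Definition R_ap {d} (U : gT -> 'M[C]_d) (psi phi : 'cV[C]_d) : \bar R :=
  ereal_sup [set r%:E | r in [set r : R | 0 <= r /\ achievable_ap U psi phi r]].

End Quantum.

(* Main.v *)
(**
  For pure states [Sym_G = G_0], so the first case always applies, and every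
  rate is achieved by a measure-and-prepare channel.  The states [U(g)^N psi^N]
  with [g] in different cosets of [Sym_G(psi)] are asymptotically orthogonal,
  since their overlaps are [|chi_psi|^N].  With [v = psi^N] and
  [L = sum_g |chi_v(g)|], the operators
    [L^-1 |g v><g v| + |G|^-1 (1 - L^-1 sum_h |h v><h v|)]
  form a covariant POVM, positive by a Gershgorin bound on the Gram matrix of
  the orbit.  Preparing [U(g) phi^M] on outcome [g] is covariant and yields
  [phi^M] from [v] except with probability at most the sum of [|chi_psi(g)|^N]
  over the [g] with [|chi_psi(g)| < 1], which tends to 0 regardless of [M].
*)
Require Import Defs.
From HB Require Import structures.
From mathcomp Require Import all_boot all_order all_algebra all_fingroup.
From mathcomp Require Import all_classical all_reals all_analysis.
From mathcomp Require Import complex mxtens.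
Import Order.TTheory GRing.Theory Num.Theory.
Local Open Scope ring_scope.
Local Open Scope classical_set_scope.

Set Implicit Arguments.
Unset Strict Implicit.
Unset Printing Implicit Defensive.

(** * Adjoints, rank-one projections and overlaps of unit vectors *)

Section Adjoint.
Context {R : realType}.
Local Notation C := R[i].

Lemma adjmxE m n (A : 'M[C]_(m, n)) i j : adjmx A i j = Num.conj (A j i).
Proof. by rewrite !mxE. Qed.

Lemma adjmxK m n (A : 'M[C]_(m, n)) : adjmx (adjmx A) = A.
Proof. by apply/matrixP => i j; rewrite !adjmxE conjCK. Qed.

Lemma adjmxM m n p (A : 'M[C]_(m, n)) (B : 'M[C]_(n, p)) :
  adjmx (A *m B) = adjmx B *m adjmx A.
Proof. by rewrite /adjmx map_mxM trmx_mul. Qed.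

Lemma adjmxD m n (A B : 'M[C]_(m, n)) : adjmx (A + B) = adjmx A + adjmx B.
Proof. by apply/matrixP => i j; rewrite !mxE rmorphD. Qed.

Lemma adjmxB m n (A B : 'M[C]_(m, n)) : adjmx (A - B) = adjmx A - adjmx B.
Proof. by apply/matrixP => i j; rewrite !mxE rmorphB. Qed.

Lemma adjmxZ m n (a : C) (A : 'M[C]_(m, n)) :
  adjmx (a *: A) = Num.conj a *: adjmx A.
Proof. by apply/matrixP => i j; rewrite !mxE rmorphM. Qed.

Lemma adjmx0 m n : adjmx (0 : 'M[C]_(m, n)) = 0.
Proof. by apply/matrixP => i j; rewrite !mxE conjC0. Qed.

Lemma adjmx_sum m n (I : Type) (s : seq I) (P : pred I)
    (F : I -> 'M[C]_(m, n)) :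
  adjmx (\sum_(i <- s | P i) F i) = \sum_(i <- s | P i) adjmx (F i).
Proof. exact: (big_morph _ (@adjmxD m n) (adjmx0 m n)). Qed.

Lemma adjmx1 n : adjmx (1%:M : 'M[C]_n) = 1%:M.
Proof. by apply/matrixP => i j; rewrite !mxE conjC_nat eq_sym. Qed.

Lemma adjmx_tens m n p q (A : 'M[C]_(m, n)) (B : 'M[C]_(p, q)) :
  adjmx (A *t B) = adjmx A *t adjmx B.
Proof. by apply/matrixP => i j; rewrite !mxE rmorphM. Qed.

Lemma adjmx_dens n (v : 'cV[C]_n) : adjmx (dens v) = dens v.
Proof. by rewrite /dens adjmxM adjmxK. Qed.

Lemma dens_mul m n (A : 'M[C]_(m, n)) (v : 'cV[C]_n) :
  dens (A *m v) = A *m dens v *m adjmx A.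
Proof. by rewrite /dens adjmxM !mulmxA. Qed.

Lemma densZ n (a : C) (v : 'cV[C]_n) : dens (a *: v) = `|a| ^+ 2 *: dens v.
Proof. by rewrite /dens adjmxZ -scalemxAl -scalemxAr scalerA normCK. Qed.

Lemma quad_sum n (v : 'cV[C]_n) :
  (adjmx v *m v) 0 0 = \sum_i `|v i 0| ^+ 2.
Proof. by rewrite mxE; apply: eq_bigr => i _; rewrite adjmxE normCKC. Qed.

Lemma quad_ge0 n (v : 'cV[C]_n) : 0 <= (adjmx v *m v) 0 0.
Proof. by rewrite quad_sum sumr_ge0 // => i _; rewrite exprn_ge0. Qed.

Lemma quad_eq0 n (v : 'cV[C]_n) : (adjmx v *m v) 0 0 = 0 -> v = 0.
Proof.
rewrite quad_sum => /eqP; rewrite psumr_eq0; last first.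
  by move=> i _; rewrite exprn_ge0.
move=> /allP v0; apply/colP => i; rewrite mxE; apply/eqP.
by have := v0 i (mem_index_enum i); rewrite /= sqrf_eq0 normr_eq0.
Qed.

Lemma tr_dens_pair n (u v : 'cV[C]_n) :
  \tr (dens u *m dens v) = `|(adjmx u *m v) 0 0| ^+ 2.
Proof.
rewrite normCK -adjmxE adjmxM adjmxK /dens mulmxA mxtrace_mulC !mulmxA.
by rewrite -mulmxA trace_mx11 mxE big_ord1 mulrC.
Qed.

Lemma tr_dens n (v : 'cV[C]_n) : \tr (dens v) = (adjmx v *m v) 0 0.
Proof. by rewrite /dens mxtrace_mulC trace_mx11. Qed.

(** The vector [u - c v] is the component of [u] orthogonal to [v]. Its squared norm gives both
    Cauchy-Schwarz for unit vectors and the equality case. *)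
Lemma unit_braket n (u v : 'cV[C]_n) (c := (adjmx v *m u) 0 0) :
  is_pure_state u -> is_pure_state v ->
  (adjmx (u - c *: v) *m (u - c *: v)) 0 0 = 1 - `|c| ^+ 2.
Proof.
rewrite /is_pure_state => u1 v1.
have cE : (adjmx u *m v) 0 0 = Num.conj c by rewrite -adjmxE adjmxM adjmxK.
rewrite adjmxB adjmxZ mulmxBl !mulmxBr -!scalemxAl -!scalemxAr.
have entB (A B : 'M[C]_1) : (A - B) 0 0 = A 0 0 - B 0 0 by rewrite !mxE.
have entZ a (A : 'M[C]_1) : (a *: A) 0 0 = a * A 0 0 by rewrite !mxE.
by rewrite !entB !entZ u1 v1 cE -/c normCK mulr1 [_ * c]mulrC subrr subr0.
Qed.

Lemma braket_le1 n (u v : 'cV[C]_n) :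
  is_pure_state u -> is_pure_state v -> `|(adjmx v *m u) 0 0| <= 1.
Proof.
move=> u1 v1; rewrite -(@expr_le1 _ 2) // -subr_ge0 -unit_braket //.
exact: quad_ge0.
Qed.

(** Here the component of [u] orthogonal to [v] vanishes, so [u] is a phase times [v], and [dens]
    forgets the phase. *)
Lemma braket_eq1 n (u v : 'cV[C]_n) :
  is_pure_state u -> is_pure_state v -> `|(adjmx v *m u) 0 0| = 1 ->
  dens u = dens v.
Proof.
move=> u1 v1 c1; have := unit_braket u1 v1.
rewrite c1 expr1n subrr => /quad_eq0/eqP; rewrite subr_eq0 => /eqP ->.
by rewrite densZ c1 expr1n scale1r.
Qed.

(** * Positive semidefinite matrices *)

Lemma psd_conj m n (B : 'M[C]_(m, n)) X : psd X -> psd (B *m X *m adjmx B).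
Proof.
move=> pX v; have := pX (adjmx B *m v).
by rewrite adjmxM adjmxK !mulmxA.
Qed.

Lemma psd_diag n (X : 'M[C]_n) i : psd X -> 0 <= X i i.
Proof.
move=> /(_ (delta_mx i 0)).
have -> : adjmx (delta_mx i 0 : 'cV[C]_n) = delta_mx 0 i.
  by apply/matrixP => j k; rewrite !mxE conjC_nat andbC.
by rewrite -rowE -colE !mxE.
Qed.

Lemma psd_tr n (X : 'M[C]_n) : psd X -> 0 <= \tr X.
Proof. by move=> pX; apply: sumr_ge0 => i _; apply: psd_diag. Qed.

Lemma psdD n (X Y : 'M[C]_n) : psd X -> psd Y -> psd (X + Y).
Proof. by move=> pX pY v; rewrite mulmxDr mulmxDl mxE addr_ge0. Qed.

Lemma psdZ n a (X : 'M[C]_n) : 0 <= a -> psd X -> psd (a *: X).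
Proof. by move=> a0 pX v; rewrite -scalemxAr -scalemxAl mxE mulr_ge0. Qed.

Lemma psd0 n : psd (0 : 'M[C]_n).
Proof. by move=> v; rewrite mulmx0 mul0mx mxE. Qed.

Lemma psd_sum n (I : Type) (s : seq I) (P : pred I) (F : I -> 'M[C]_n) :
  (forall i, P i -> psd (F i)) -> psd (\sum_(i <- s | P i) F i).
Proof.
by move=> pF; apply: (big_ind (@psd R n)) => //; [exact: psd0|exact: psdD].
Qed.

Lemma psd_dens n (v : 'cV[C]_n) : psd (dens v).
Proof.
move=> u; rewrite /dens mulmxA -mulmxA.
have -> : adjmx v *m u = adjmx (adjmx u *m v).
  by rewrite adjmxM adjmxK.
by rewrite mxE big_ord1 adjmxE mul_conjC_ge0.
Qed.

(** * Spectral decomposition and the trace norm *)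

Lemma hermitian_spectral n (A : 'M[C]_n) : adjmx A = A ->
  exists P (l : 'rV[C]_n), P *m adjmx P = 1%:M /\ A = adjmx P *m diag_mx l *m P.
Proof.
move=> hA; have tE m p (B : 'M[C]_(m, p)) : map_mx Num.conj B^T = adjmx B.
  by rewrite /adjmx map_trmx.
have /orthomx_spectralP : A \is normalmx.
  by apply/normalmxP; rewrite tE hA.
have Pu := spectral_unitarymx A; rewrite invmx_unitary // tE.
exists (spectralmx A), (spectral_diag A); split=> //; rewrite -tE.
exact/unitarymxP.
Qed.

Lemma psd_factor n (F : 'M[C]_n) : adjmx F = F -> psd F ->
  exists A : 'M[C]_n, F = adjmx A *m A.
Proof.
move=> /hermitian_spectral[P [l [PP ->]]] pF.
have l_ge0 i : 0 <= l 0 i.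
  have := psd_diag i (psd_conj P pF).
  by rewrite !mulmxA PP mul1mx -mulmxA PP mulmx1 mxE eqxx.
exists (diag_mx (map_mx sqrtC l) *m P).
rewrite adjmxM -!mulmxA; congr (_ *m _); rewrite !mulmxA; congr (_ *m _).
apply/matrixP => i j; rewrite mul_mx_diag !mxE eq_sym.
have [->|_] := eqVneq i j; last by rewrite !mulr0n conjC0 mul0r.
rewrite !mulr1n (CrealP _) -?expr2 ?sqrtCK //.
by apply: ger0_real; rewrite sqrtC_ge0.
Qed.

(** With [F = A^* A], cyclicity turns the trace into that of [A Z A^*], which is positive. It makes
    outcome probabilities nonnegative. *)
Lemma psd_pair n (F Z : 'M[C]_n) :
  adjmx F = F -> psd F -> psd Z -> 0 <= \tr (F *m Z).
Proof.
move=> hF pF pZ; have [A ->] := psd_factor hF pF.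
by rewrite -mulmxA mxtrace_mulC; apply/psd_tr/psd_conj.
Qed.

Lemma char_poly_unitary n (P D : 'M[C]_n) : P *m adjmx P = 1%:M ->
  char_poly (adjmx P *m D *m P) = char_poly D.
Proof.
move=> PP; rewrite /char_poly.
have PP' : adjmx P *m P = 1%:M by apply: mulmx1C.
have -> : char_poly_mx (adjmx P *m D *m P)
    = map_mx polyC (adjmx P) *m char_poly_mx D *m map_mx polyC P.
  rewrite /char_poly_mx mulmxBr mulmxBl -!map_mxM; congr (_ - _).
  by rewrite mul_mx_scalar -scalemxAl -map_mxM PP' map_mx1 scalemx1.
by rewrite !det_mulmx mulrC mulrA -det_mulmx -map_mxM PP map_mx1 det1 mul1r.
Qed.

(** The list [eigs] is a chosen factorization of the characteristic polynomial, so its order is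
    unknown. Equality up to permutation suffices for the sum in [trnorm]. *)
Lemma eigs_unitary_diag n (P : 'M[C]_n) (l : 'rV[C]_n) : P *m adjmx P = 1%:M ->
  perm_eq (eigs (adjmx P *m diag_mx l *m P)) [seq l 0 i | i : 'I_n].
Proof.
move=> PP; rewrite /eigs; case: closed_field_poly_normal => s /=.
rewrite char_poly_unitary // (monicP (char_poly_monic _)) scale1r => es.
apply: prod_XsubC_eq; rewrite -es char_poly_trig ?diag_mx_is_trig //.
rewrite big_image /=; by apply: eq_bigr => i _; rewrite mxE eqxx.
Qed.

(** In an eigenbasis of [B - D] the singular values are [|b_i - d_i|], where [b_i] and [d_i] are the
    nonnegative diagonal entries of [B] and [D] in that basis. Each is at most [b_i + d_i], and
    these sum to the two traces. *)
Lemma trnorm_sub_psd n (B D : 'M[C]_n) : adjmx B = B -> adjmx D = D ->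
  psd B -> psd D -> trnorm (B - D) <= \tr B + \tr D.
Proof.
move=> hB hD pB pD.
have hA : adjmx (B - D) = B - D by rewrite adjmxB hB hD.
have [P [l [PP eA]]] := hermitian_spectral hA.
have PP' : adjmx P *m P = 1%:M by apply: mulmx1C.
have lE i : l 0 i = (P *m B *m adjmx P) i i - (P *m D *m adjmx P) i i.
  transitivity ((P *m (B - D) *m adjmx P) i i).
    by rewrite eA !mulmxA PP mul1mx -mulmxA PP mulmx1 mxE eqxx.
  by rewrite mulmxBr mulmxBl !mxE.
have PB i : 0 <= (P *m B *m adjmx P) i i by apply/psd_diag/psd_conj.
have PD i : 0 <= (P *m D *m adjmx P) i i by apply/psd_diag/psd_conj.
have AA : adjmx (B - D) *m (B - D)
    = adjmx P *m diag_mx (\row_j (l 0 j * l 0 j)) *m P.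
  rewrite hA eA -mulmx_diag !mulmxA; congr (_ *m _ *m _).
  by rewrite -[_ *m P *m adjmx P]mulmxA PP mulmx1.
rewrite /trnorm AA (perm_big _ (eigs_unitary_diag _ PP)) big_image /=.
have trE (X : 'M[C]_n) : \tr X = \sum_i (P *m X *m adjmx P) i i.
  transitivity (\tr (P *m X *m adjmx P)) => //.
  by rewrite -mulmxA mxtrace_mulC -mulmxA PP' mulmx1.
rewrite (trE B) (trE D) -big_split /=; apply: ler_sum => i _.
rewrite mxE -expr2 -real_normK; last by rewrite lE rpredB // ger0_real.
by rewrite sqrCK // lE (le_trans (ler_normB _ _)) // !ger0_norm.
Qed.

End Adjoint.

(** * Completely positive maps and measure-and-prepare channels *)

Section Channels.
Context {R : realType}.
Local Notation C := R[i].

Lemma tensmxDr m n p q (A : 'M[C]_(m, n)) (B D : 'M[C]_(p, q)) :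
  A *t (B + D) = A *t B + A *t D.
Proof. by apply/matrixP => i j; rewrite !mxE mulrDr. Qed.

Lemma blk_sum k m (X : 'M[C]_(k * m)) :
  X = \sum_(i < k) \sum_(j < k) (delta_mx i j *t blk X i j).
Proof.
apply/matrixP => p q.
case: (mxtens_indexP p) => i a; case: (mxtens_indexP q) => j b.
rewrite summxE (bigD1 i) //= summxE (bigD1 j) //= tensmxE !mxE !eqxx mul1r.
rewrite !big1 ?addr0 // => [i' /negPf ii|j' /negPf jj].
  by rewrite summxE big1 // => j' _; rewrite tensmxE !mxE eq_sym ii mul0r.
by rewrite tensmxE !mxE [j == _]eq_sym jj andbF mul0r.
Qed.

(** The amplified map is itself a conjugation, by [1 *t K]. *)
Lemma is_CP_kraus m n (K : 'M[C]_(n, m)) : is_CP (fun X => K *m X *m adjmx K).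
Proof.
move=> k X pX.
have -> : ampl (k := k) (fun X => K *m X *m adjmx K) X
    = (1%:M *t K) *m X *m adjmx (1%:M *t K).
  rewrite {2}(blk_sum X) mulmx_sumr mulmx_suml; apply: eq_bigr => i _.
  rewrite mulmx_sumr mulmx_suml; apply: eq_bigr => j _.
  by rewrite adjmx_tens adjmx1 !tensmx_mul mul1mx mulmx1.
exact: psd_conj.
Qed.

Lemma is_CP_sum m n (I : Type) (s : seq I) (Phi : I -> 'M[C]_m -> 'M[C]_n) :
  (forall i, is_CP (Phi i)) -> is_CP (fun X => \sum_(i <- s) Phi i X).
Proof.
move=> cp k X pX.
have -> : ampl (k := k) (fun X => \sum_(i <- s) Phi i X) X
    = \sum_(i <- s) ampl (k := k) (Phi i) X.
  rewrite /ampl [RHS]exchange_big; apply: eq_bigr => i _.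
  rewrite [RHS]exchange_big; apply: eq_bigr => j _.
  apply: (big_morph _ (@tensmxDr _ _ _ _ _)); exact: tensmx0.
by apply: psd_sum => i _; apply: cp.
Qed.

(* Writing [F = A^* A], the Kraus operators are [w e_a^* A]. *)
Lemma is_CP_measure_prepare m n (F : 'M[C]_m) (w : 'cV[C]_n) :
  adjmx F = F -> psd F -> is_CP (fun X => \tr (F *m X) *: dens w).
Proof.
move=> hF pF; have [A eF] := psd_factor hF pF.
have -> : (fun X => \tr (F *m X) *: dens w) =
    (fun X => \sum_i (w *m row i A) *m X *m adjmx (w *m row i A)).
  apply: funext => X; rewrite eF -mulmxA mxtrace_mulC scaler_suml.
  apply: eq_bigr => i _; rewrite adjmxM !mulmxA -!(mulmxA w).
  have -> : row i A *m X *m adjmx (row i A) = ((A *m X *m adjmx A) i i)%:M.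
    rewrite [LHS]mx11_scalar -row_mul; congr (_%:M).
    by rewrite !mxE; apply: eq_bigr => j _; rewrite !mxE.
  by rewrite mul_scalar_mx -scalemxAr.
by apply: is_CP_sum => i; apply: is_CP_kraus.
Qed.

Section MeasurePrepare.
Context {I : finType} {m n : nat}.
Variables (F : I -> 'M[C]_m) (w : I -> 'cV[C]_n).
Definition measure_prepare (X : 'M[C]_m) : 'M[C]_n :=
  \sum_i \tr (F i *m X) *: dens (w i).

Lemma measure_prepare_CPTP :
  (forall i, adjmx (F i) = F i) -> (forall i, psd (F i)) ->
  \sum_i F i = 1%:M -> (forall i, is_pure_state (w i)) ->
  is_CPTP measure_prepare.
Proof.
move=> hF pF F1 w1; split; [|split].
- move=> a X Y; rewrite /measure_prepare scaler_sumr -big_split /=.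
  apply: eq_bigr => i _.
  by rewrite mulmxDr -scalemxAr linearD linearZ /= scalerDl scalerA.
- by apply: is_CP_sum => i; apply: is_CP_measure_prepare.
- move=> X; rewrite /measure_prepare linear_sum /=.
  under eq_bigr do rewrite linearZ /= tr_dens (w1 _) mulr1.
  by rewrite -linear_sum -mulmx_suml F1 mul1mx.
Qed.

End MeasurePrepare.
End Channels.

(** * The covariant orbit measurement and the conversion built on it *)

Section CovariantConversion.
Context {R : realType} {gT : finGroupType}.
Local Notation C := R[i].

Section Rep.
Context {m : nat} (V : gT -> 'M[C]_m).
Hypothesis repV : is_proj_unitary_rep V.

Lemma rep_unitaryl g : adjmx (V g) *m V g = 1%:M.
Proof. by apply: mulmx1C; case: repV. Qed.

Lemma rep_pure g v : is_pure_state v -> is_pure_state (V g *m v).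
Proof.
rewrite /is_pure_state adjmxM !mulmxA -(mulmxA _ (adjmx _)).
by rewrite rep_unitaryl mulmx1.
Qed.

Lemma rep_dens g h v : dens (V g *m (V h *m v)) = dens (V (g * h)%g *m v).
Proof.
have [_ /(_ g h)[c [c1 e]]] := repV.
by rewrite mulmxA e -scalemxAl densZ c1 expr1n scale1r.
Qed.

Lemma rep_conj_dens g h v :
  V g *m dens (V h *m v) *m adjmx (V g) = dens (V (g * h)%g *m v).
Proof. by rewrite -dens_mul rep_dens. Qed.

(** The phase in [V g V(g^-1 h) = c V h] disappears in the modulus. Hence the absolute Gram matrix
    of the orbit depends only on [g^-1 h]. *)
Lemma rep_braket g h v :
  `|(adjmx (V g *m v) *m (V h *m v)) 0 0| = `|chi V v (g^-1 * h)%g|.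
Proof.
have [_ /(_ g (g^-1 * h)%g)[c [c1]]] := repV; rewrite mulKVg => e.
rewrite /chi -[V (g^-1 * h)%g]mul1mx -(rep_unitaryl g).
rewrite -(mulmxA (adjmx (V g))) e.
rewrite -2!scalemxAr -scalemxAl [in RHS]mxE normrM c1 mul1r.
by rewrite adjmxM !mulmxA.
Qed.

Lemma norm_chi_le1 v g : is_pure_state v -> `|chi V v g| <= 1.
Proof.
by move=> v1; rewrite /chi -mulmxA braket_le1 //; apply: rep_pure.
Qed.

(** Forwards, this is equality in Cauchy-Schwarz. Backwards, [|chi|^2] is the trace of the product
    of the two projections, which is 1 when they coincide. *)
Lemma norm_chi_eq1 v g : is_pure_state v ->
  (`|chi V v g| = 1) <-> (V g *m dens v *m adjmx (V g) = dens v).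
Proof.
move=> v1; split=> [c1|e].
  rewrite -dens_mul; apply: braket_eq1 => //; first exact: rep_pure.
  by rewrite mulmxA.
have := tr_dens_pair v (V g *m v).
rewrite dens_mul e tr_dens_pair v1 normr1 expr1n mulmxA => /esym/eqP.
by rewrite sqrp_eq1 ?normr_ge0 // => /eqP.
Qed.

Lemma norm_chi1 v : is_pure_state v -> `|chi V v 1%g| = 1.
Proof.
by move=> v1; rewrite -(mulVg 1%g) -rep_braket (rep_pure _ v1) normr1.
Qed.

(** The common absolute row and column sum of the Gram matrix of the orbit, hence an upper bound for
    the norm of the sum of the orbit projections. *)
Definition chi_sum v : C := \sum_g `|chi V v g|.

Lemma chi_sum_ge1 v : is_pure_state v -> 1 <= chi_sum v.
Proof.
move=> v1; rewrite /chi_sum (bigD1 1%g) //= norm_chi1 // lerDl.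
by apply: sumr_ge0.
Qed.

Lemma conj_chi_sumV v : Num.conj (chi_sum v)^-1 = (chi_sum v)^-1.
Proof.
by apply/CrealP; rewrite rpredV rpred_sum // => g _; apply: normr_real.
Qed.

Definition orbit_rest v : 'M[C]_m :=
  1%:M - (chi_sum v)^-1 *: \sum_g dens (V g *m v).

Lemma adjmx_orbit_rest v : adjmx (orbit_rest v) = orbit_rest v.
Proof.
rewrite /orbit_rest adjmxB adjmx1 adjmxZ adjmx_sum.
under eq_bigr do rewrite adjmx_dens.
by rewrite conj_chi_sumV.
Qed.

Lemma orbit_rest_conj v h :
  V h *m orbit_rest v *m adjmx (V h) = orbit_rest v.
Proof.
rewrite /orbit_rest mulmxBr mulmxBl mulmx1; case: (repV) => -> _.
rewrite -scalemxAr -scalemxAl; congr (_ - _ *: _).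
rewrite mulmx_sumr mulmx_suml [RHS](reindex_inj (mulgI h)).
by apply: eq_bigr => g _; rewrite rep_conj_dens.
Qed.

(* The frame bound [sum_g |<V g v, u>|^2 <= L |u|^2], with [L] the largest
   absolute row sum of the Gram matrix of the orbit, comes from expanding
   [0 <= |L u - sum_g <V g v, u> V g v|^2]. *)
Lemma psd_orbit_rest v : is_pure_state v -> psd (orbit_rest v).
Proof.
move=> v1 u; set L := chi_sum v.
have L_gt0 : 0 < L by apply: lt_le_trans (chi_sum_ge1 v1).
have LR : Num.conj L = L by apply/CrealP/ger0_real/ltW.
pose a g := (adjmx (V g *m v) *m u) 0 0.
pose S := \sum_g `|a g| ^+ 2.
pose z := \sum_g a g *: (V g *m v).
have entB (A B : 'M[C]_1) : (A - B) 0 0 = A 0 0 - B 0 0 by rewrite !mxE.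
have entZ b (A : 'M[C]_1) : (b *: A) 0 0 = b * A 0 0 by rewrite !mxE.
have quE : (adjmx u *m orbit_rest v *m u) 0 0 = (adjmx u *m u) 0 0 - L^-1 * S.
  rewrite /orbit_rest mulmxBr mulmxBl mulmx1 -scalemxAr -scalemxAl.
  rewrite mulmx_sumr mulmx_suml.
  rewrite entB entZ summxE; congr (_ - _ * _); apply: eq_bigr => g _.
  rewrite -tr_dens_pair mxtrace_mulC /dens -!mulmxA mxtrace_mulC -!mulmxA.
  by rewrite trace_mx11 !mulmxA.
have uz : (adjmx u *m z) 0 0 = S.
  rewrite mulmx_sumr summxE; apply: eq_bigr => g _.
  rewrite -scalemxAr mxE normCK; congr (_ * _).
  by rewrite -adjmxE adjmxM adjmxK.
have zu : (adjmx z *m u) 0 0 = S.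
  have -> : adjmx z *m u = adjmx (adjmx u *m z) by rewrite adjmxM adjmxK.
  rewrite adjmxE uz; apply/CrealP/ger0_real/sumr_ge0 => g _.
  by rewrite exprn_ge0.
have zz : (adjmx z *m z) 0 0 <= L * S.
  have row_sum g : \sum_h `|chi V v (g^-1 * h)%g| = L.
    by rewrite /L /chi_sum [RHS](reindex_inj (mulgI g^-1%g)).
  have col_sum h : \sum_g `|chi V v (g^-1 * h)%g| = L.
    rewrite /L /chi_sum [RHS](reindex_inj (can_inj invgK)) /=.
    rewrite [RHS](reindex_inj (mulgI h^-1%g)) /=.
    by apply: eq_bigr => g _; rewrite invMg invgK.
  have zE : (adjmx z *m z) 0 0 = \sum_g \sum_h Num.conj (a g) * a h *
      (adjmx (V g *m v) *m (V h *m v)) 0 0.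
    rewrite /z adjmx_sum mulmx_suml summxE; apply: eq_bigr => g _.
    rewrite mulmx_sumr summxE; apply: eq_bigr => h _.
    by rewrite adjmxZ -scalemxAl -scalemxAr scalerA mxE.
  have z0 := quad_ge0 z; rewrite -(ger0_norm z0) zE.
  apply: le_trans (ler_norm_sum _ _ _) _.
  (* Schur test: the bound [xy <= (x^2 + y^2)/2] splits the double sum in two; one half is summed
     along rows, the other along columns, and each gives [L S / 2]. *)
  apply: (@le_trans _ _ (\sum_g \sum_h (`|a g| ^+ 2 + `|a h| ^+ 2) / 2
      * `|chi V v (g^-1 * h)%g|)).
    apply: ler_sum => g _; apply: le_trans (ler_norm_sum _ _ _) _.
    apply: ler_sum => h _; rewrite !normrM norm_conjC rep_braket.
    apply: ler_wpM2r => //; rewrite ler_pdivlMr // mulr_natr.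
    have : (`|a g| - `|a h|) ^+ 2 >= 0.
      by rewrite real_exprn_even_ge0 // rpredB // normr_real.
    by rewrite sqrrB addrAC subr_ge0.
  have -> : \sum_g \sum_h (`|a g| ^+ 2 + `|a h| ^+ 2) / 2
      * `|chi V v (g^-1 * h)%g|
     = \sum_g \sum_h `|a g| ^+ 2 / 2 * `|chi V v (g^-1 * h)%g|
     + \sum_g \sum_h `|a h| ^+ 2 / 2 * `|chi V v (g^-1 * h)%g|.
    rewrite -big_split /=; apply: eq_bigr => g _; rewrite -big_split /=.
    by apply: eq_bigr => h _; rewrite mulrDl mulrDl.
  rewrite [X in _ + X]exchange_big /=.
  under eq_bigr do rewrite -mulr_sumr row_sum.
  under [X in _ + X]eq_bigr do rewrite -mulr_sumr col_sum.
  by rewrite -!mulr_suml -/S -mulrDl -splitr mulrC.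
(* The goal becomes [0 <= L (L |u|^2 - S)]. The square of [L u - z] is [L^2 |u|^2 - 2 L S + |z|^2],
   and [|z|^2 <= L S] bounds it by this product. *)
rewrite quE subr_ge0 ler_pdivrMl // -subr_ge0 -(pmulr_rge0 _ L_gt0).
have := quad_ge0 (L *: u - z); rewrite adjmxB adjmxZ LR mulmxBl !mulmxBr.
rewrite -!scalemxAl -!scalemxAr.
rewrite !entB !entZ uz zu => /le_trans; apply.
by rewrite mulrBr lerBlDr lerDl subr_ge0.
Qed.

(** The remainder is invariant under conjugation, so sharing it equally completes the measurement
    while [V h] still permutes the outcomes by left translation. *)
Definition orbit_povm v g : 'M[C]_m :=
  (chi_sum v)^-1 *: dens (V g *m v) + #|gT|%:R^-1 *: orbit_rest v.

Lemma adjmx_orbit_povm v g :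
  adjmx (orbit_povm v g) = orbit_povm v g.
Proof.
rewrite /orbit_povm adjmxD !adjmxZ adjmx_dens adjmx_orbit_rest conj_chi_sumV.
suff -> : Num.conj (#|gT|%:R^-1 : C) = #|gT|%:R^-1 by [].
by apply/CrealP; rewrite rpredV realn.
Qed.

Lemma psd_orbit_povm v g : is_pure_state v -> psd (orbit_povm v g).
Proof.
move=> v1; apply: psdD; apply: psdZ; rewrite ?invr_ge0 ?ler0n //.
- by apply: le_trans (chi_sum_ge1 v1).
- exact: psd_dens.
- exact: psd_orbit_rest.
Qed.

Lemma sum_orbit_povm v : \sum_g orbit_povm v g = 1%:M.
Proof.
rewrite big_split /= -scaler_sumr sumr_const -[#|xpredT|]/(#|gT|) scalerMnl.
rewrite -mulr_natr mulVf ?scale1r; first by rewrite /orbit_rest addrC subrK.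
by rewrite pnatr_eq0 -lt0n; apply/card_gt0P; exists 1%g.
Qed.

Lemma orbit_povm_conj v g h :
  V h *m orbit_povm v g *m adjmx (V h) = orbit_povm v (h * g)%g.
Proof.
rewrite /orbit_povm mulmxDr mulmxDl -!scalemxAr -!scalemxAl rep_conj_dens.
by rewrite orbit_rest_conj.
Qed.

(** Such a [g] fixes [dens v], so the orbit term contributes exactly [L^-1]; the remainder can only
    add to it. *)
Lemma tr_orbit_povm_ge v g : is_pure_state v -> `|chi V v g| = 1 ->
  (chi_sum v)^-1 <= \tr (orbit_povm v g *m dens v).
Proof.
move=> v1 /(norm_chi_eq1 _ v1) e.
rewrite /orbit_povm dens_mul e mulmxDl -!scalemxAl linearD !linearZ /=.
rewrite tr_dens_pair v1 normr1 expr1n mulr1 lerDl mulr_ge0 ?invr_ge0 ?ler0n //.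
apply: psd_pair; first exact: adjmx_orbit_rest.
  exact: psd_orbit_rest.
exact: psd_dens.
Qed.

End Rep.

(** The predicate [H] marks outcomes after which the prepared state is exactly [dens w]. The error
    is thus at most the probability of an outcome outside [H], whatever the output space. *)
Lemma covariant_conversion m n (V : gT -> 'M[C]_m) (W : gT -> 'M[C]_n)
    (v : 'cV[C]_m) (w : 'cV[C]_n) (H : pred gT) :
  is_proj_unitary_rep V -> is_proj_unitary_rep W ->
  is_pure_state v -> is_pure_state w ->
  (forall g, H g -> `|chi V v g| = 1) ->
  (forall g, H g -> dens (W g *m w) = dens w) ->
  exists Phi : 'M[C]_m -> 'M[C]_n, is_CPTP Phi /\
    (forall g X, Phi (V g *m X *m adjmx (V g)) = W g *m Phi X *m adjmx (W g)) /\
    tdist (dens w) (Phi (dens v)) <= \sum_(g | ~~ H g) `|chi V v g|.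
Proof.
move=> repV repW v1 w1 chi1 stab.
have F_herm g := adjmx_orbit_povm V v g.
have F_psd g := psd_orbit_povm repV g v1.
exists (measure_prepare (orbit_povm V v) (fun g => W g *m w)).
have cptp : is_CPTP (measure_prepare (orbit_povm V v) (fun g => W g *m w)).
  apply: measure_prepare_CPTP => // [|g]; first exact: sum_orbit_povm.
  exact: rep_pure.
split=> //; split=> [h X|].
  (* Covariance: translate the outcomes by [h], then move [V h] from the state to the measurement
     operator by cyclicity of the trace. *)
  rewrite /measure_prepare mulmx_sumr mulmx_suml (reindex_inj (mulgI h)).
  apply: eq_bigr => g _; rewrite -scalemxAr -scalemxAl rep_conj_dens //.
  congr (_ *: _); rewrite -orbit_povm_conj // -!mulmxA mxtrace_mulC -!mulmxA.
  by rewrite rep_unitaryl // mulmx1 (mulmxA (adjmx _)) rep_unitaryl // mul1mx.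
set a := fun g => \tr (orbit_povm V v g *m dens v).
have a_ge0 g : 0 <= a g by apply: psd_pair => //; apply: psd_dens.
have suma : \sum_g a g = 1.
  transitivity (\tr (1%:M *m dens v)); last by rewrite mul1mx tr_dens.
  by rewrite -(sum_orbit_povm V v) mulmx_suml linear_sum.
set s := \sum_(g | ~~ H g) a g.
have s_ge0 : 0 <= s by apply: sumr_ge0.
have aH : \sum_(g | H g) a g = 1 - s.
  by apply/eqP; rewrite eq_sym subr_eq -suma (bigID H).
rewrite /tdist.
(* Outcomes in [H] produce [(1 - s) dens w]. What is left is a difference of two positive matrices
   of trace [s], so its trace norm is at most [2 s], and the 2 cancels the one in [tdist]. *)
have -> : dens w - measure_prepare (orbit_povm V v) (fun g => W g *m w) (dens v)
    = s *: dens w - \sum_(g | ~~ H g) a g *: dens (W g *m w).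
  rewrite /measure_prepare (bigID H) /=.
  rewrite (eq_bigr (fun g => a g *: dens w)) => [|g /stab -> //].
  rewrite -scaler_suml aH opprD addrA; congr (_ - _).
  by rewrite -[X in X - _]scale1r -scalerBl subKr.
rewrite ler_pdivrMr // mulr_natr.
have hD : adjmx (\sum_(g | ~~ H g) a g *: dens (W g *m w))
    = \sum_(g | ~~ H g) a g *: dens (W g *m w).
  rewrite adjmx_sum; apply: eq_bigr => g _.
  by rewrite adjmxZ adjmx_dens (CrealP _) // ger0_real.
have trD : \tr (\sum_(g | ~~ H g) a g *: dens (W g *m w)) = s.
  rewrite linear_sum; apply: eq_bigr => g _.
  by rewrite linearZ /= tr_dens (rep_pure repW g w1) mulr1.
apply: le_trans (trnorm_sub_psd _ hD _ _) _.
- by rewrite adjmxZ adjmx_dens (CrealP _) // ger0_real.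
- by apply: psdZ => //; apply: psd_dens.
- by apply: psd_sum => g _; apply: psdZ => //; apply: psd_dens.
rewrite trD linearZ /= tr_dens w1 mulr1 -mulr2n lerMn2r /=.
have L_ge1 := chi_sum_ge1 repV v1.
have L_gt0 : 0 < chi_sum V v by apply: lt_le_trans L_ge1.
(* Each outcome in [H] has probability at least [L^-1]. As [|chi| = 1] on [H], this gives
   [L s <= L - sum_H |chi|], the sum of [|chi|] outside [H]; finally [L >= 1] removes the factor. *)
have sL : s <= 1 - \sum_(g | H g) (chi_sum V v)^-1.
  rewrite -[s](subKr 1) -aH lerD2l lerN2; apply: ler_sum => g /chi1.
  exact: tr_orbit_povm_ge.
have sumH : chi_sum V v * (\sum_(g | H g) (chi_sum V v)^-1)
    = \sum_(g | H g) `|chi V v g|.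
  rewrite mulr_sumr; apply: eq_bigr => g /chi1 ->.
  by rewrite mulfV // gt_eqF.
apply: le_trans sL _; rewrite -(ler_pM2l L_gt0) mulrBr mulr1 sumH.
rewrite {1}/chi_sum (bigID H) /= addrC addrK.
by rewrite ler_peMl // sumr_ge0.
Qed.

End CovariantConversion.

(** * Tensor powers of representations and states *)

Section TensorPower.
Context {R : realType}.
Local Notation C := R[i].

Lemma tensmx11 m n : (1%:M : 'M[C]_m) *t (1%:M : 'M[C]_n) = 1%:M.
Proof.
apply/matrixP => p q.
case: (mxtens_indexP p) => i a; case: (mxtens_indexP q) => j b.
rewrite tensmxE !mxE -natrM mulnb; congr (_%:R); congr nat_of_bool.
by rewrite (inj_eq (can_inj (@mxtens_indexK m n))).
Qed.

Lemma ntensmx_mul m n p (A : 'M[C]_(m, n)) (B : 'M[C]_(n, p)) k :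
  (A *m B) ^t k = A ^t k *m B ^t k.
Proof.
(* The recursion of [^t] starts at the first power, with the zeroth treated apart, so the induction
   does too. *)
case: k => [|k]; first by rewrite !ntensmx0 mulmx1.
elim: k => [|k IHk]; first by rewrite !ntensmx1.
by rewrite !ntensmxSS IHk tensmx_mul.
Qed.

Lemma adjmx_ntens m n (A : 'M[C]_(m, n)) k : adjmx (A ^t k) = adjmx A ^t k.
Proof.
case: k => [|k]; first by rewrite !ntensmx0 adjmx1.
elim: k => [|k IHk]; first by rewrite !ntensmx1.
by rewrite !ntensmxSS adjmx_tens IHk.
Qed.

Lemma ntensmx_id m k : (1%:M : 'M[C]_m) ^t k = 1%:M.
Proof.
case: k => [|k]; first by rewrite ntensmx0.
elim: k => [|k IHk]; first by rewrite ntensmx1.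
by rewrite ntensmxSS IHk tensmx11.
Qed.

Lemma ntensmxZ m n (c : C) (A : 'M[C]_(m, n)) k :
  (c *: A) ^t k = c ^+ k *: A ^t k.
Proof.
case: k => [|k]; first by rewrite !ntensmx0 expr0 scale1r.
elim: k => [|k IHk]; first by rewrite !ntensmx1 expr1.
rewrite !ntensmxSS IHk.
by apply/matrixP => i j; rewrite !mxE [in RHS]exprS mulrACA.
Qed.

Lemma ntens_rep (gT : finGroupType) d (U : gT -> 'M[C]_d) k :
  is_proj_unitary_rep U -> is_proj_unitary_rep (fun g => U g ^t k).
Proof.
move=> [uU mU]; split=> [g|g h].
  by rewrite adjmx_ntens -ntensmx_mul uU ntensmx_id.
have [c [c1 e]] := mU g h; exists (c ^+ k); split.
  by rewrite normrX c1 expr1n.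
by rewrite -ntensmx_mul e ntensmxZ.
Qed.

(** The power [v ^t k] has [1 ^ k] columns, which is not convertible to 1 for variable [k]; the cast
    makes it a column vector. *)
Definition ntens_vec d (v : 'cV[C]_d) k : 'cV[C]_(d ^ k) :=
  castmx (erefl, exp1n k) (v ^t k).

(** A variable column count lets the equation be substituted away, together with the cast. *)
Lemma cast_col_conj n k (e : k = 1%N) (w : 'M[C]_(n, k)) :
  castmx (erefl, e) w *m adjmx (castmx (erefl, e) w) = w *m adjmx w.
Proof. by subst k; rewrite castmx_id. Qed.

Lemma cast_col_quad n k (e : k = 1%N) (w : 'M[C]_(n, k)) A b :
  adjmx w *m A *m w = b%:M ->
  (adjmx (castmx (erefl, e) w) *m A *m castmx (erefl, e) w) 0 0 = b.
Proof. by subst k; rewrite castmx_id => ->; rewrite mxE. Qed.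

Lemma dens_ntens_vec d (v : 'cV[C]_d) k : dens (ntens_vec v k) = dens v ^t k.
Proof. by rewrite /dens cast_col_conj adjmx_ntens ntensmx_mul. Qed.

Lemma ntens_vec_quad d (v : 'cV[C]_d) (A : 'M[C]_d) k :
  (adjmx (ntens_vec v k) *m A ^t k *m ntens_vec v k) 0 0 =
  (adjmx v *m A *m v) 0 0 ^+ k.
Proof.
apply: cast_col_quad; rewrite adjmx_ntens -!ntensmx_mul.
rewrite {1}[adjmx v *m A *m v]mx11_scalar -scalemx1 ntensmxZ ntensmx_id.
by rewrite scalemx1.
Qed.

Lemma ntens_vec_pure d (v : 'cV[C]_d) k :
  is_pure_state v -> is_pure_state (ntens_vec v k).
Proof.
move=> v1; rewrite /is_pure_state -[adjmx (ntens_vec v k)]mulmx1.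
rewrite -(ntensmx_id d k).
by rewrite ntens_vec_quad mulmx1 v1 expr1n.
Qed.

End TensorPower.

(** * Symmetry groups and the error of a finite conversion *)

Section Rate.
Context {R : realType} {gT : finGroupType} {d : nat}.
Local Notation C := R[i].
Variables (U : gT -> 'M[C]_d) (psi phi : 'cV[C]_d).
Hypotheses (repU : is_proj_unitary_rep U)
  (psi1 : is_pure_state psi) (phi1 : is_pure_state phi).

Lemma SymG_G0 (v : 'cV[C]_d) : is_pure_state v -> SymG U v = G0 U v.
Proof.
move=> v1; apply/seteqP; split=> g /=.
  by move=> e; apply/(norm_chi_eq1 repU).
by move=> /(norm_chi_eq1 repU g v1).
Qed.

(** Here [H] is [G0] of [psi], that is its symmetry group, which fixes [phi] by the inclusion. The
    bound is independent of [M], so it serves every rate. *)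
Lemma conversion_error N M : SymG U psi `<=` SymG U phi ->
  exists Phi : 'M[C]_(d ^ N) -> 'M[C]_(d ^ M),
    is_CPTP Phi /\ is_covariant U Phi /\
    tdist (dens phi ^t M) (Phi (dens psi ^t N))
      <= \sum_(g | `|chi U psi g| != 1) `|chi U psi g| ^+ N.
Proof.
move=> sub; have chiE g :
    `|chi (fun g => U g ^t N) (ntens_vec psi N) g| = `|chi U psi g| ^+ N.
  by rewrite /chi ntens_vec_quad normrX.
have chi1 g : `|chi U psi g| == 1 ->
    `|chi (fun g => U g ^t N) (ntens_vec psi N) g| = 1.
  by rewrite chiE => /eqP ->; rewrite expr1n.
have stab g : `|chi U psi g| == 1 ->
    dens (U g ^t M *m ntens_vec phi M) = dens (ntens_vec phi M).
  rewrite dens_mul dens_ntens_vec adjmx_ntens -!ntensmx_mul.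
  by move=> /eqP/(norm_chi_eq1 repU g psi1)/sub ->.
have [Phi [cptp [cov err]]] := covariant_conversion (ntens_rep N repU)
  (ntens_rep M repU) (ntens_vec_pure N psi1) (ntens_vec_pure M phi1) chi1 stab.
exists Phi; split=> //; split=> //.
move: err; rewrite !dens_ntens_vec; under eq_bigr do rewrite chiE.
by [].
Qed.


End Rate.

Import numFieldNormedType.Exports.

Lemma cvg_sum_pow (R : realType) (I : finType) (P : pred I) (x : I -> R) :
  (forall i, P i -> `|x i| < 1) ->
  (fun N : nat => \sum_(i | P i) x i ^+ N) @ \oo --> (0 : R).
Proof.
move=> x1.
have addc : continuous (fun z : R * R => z.1 + z.2) by exact: add_continuous.
have cvgx i : P i -> x i ^+ N @[N --> \oo] --> (0 : R).
  by move=> /x1; exact: cvg_expr.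
have := cvg_big addc (r := index_enum I) (x0 := 0) _ cvgx.
by rewrite [X in _ --> X]big1 => [H|//]; exact: H.
Qed.

Lemma achievable_all (R : realType) (gT : finGroupType) (d : nat)
    (U : gT -> 'M[R[i]]_d) (psi phi : 'cV[R[i]]_d) (r : R) :
  is_proj_unitary_rep U -> is_pure_state psi -> is_pure_state phi ->
  SymG U psi `<=` SymG U phi -> achievable_ap U psi phi r.
Proof.
move=> repU psi1 phi1 sub.
(* The errors must be real while the norm on [R[i]] takes values in [R[i]], hence [normc].
   Finiteness of the group makes this a finite sum of null geometric sequences. *)
exists (fun N => \sum_(g | `|chi U psi g| != 1)
  ComplexField.Normc.normc (chi U psi g) ^+ N).
have normE (z : R[i]) : `|z| = (ComplexField.Normc.normc z)%:C%C by [].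
split=> [|N].
  apply: cvg_sum_pow => g chi_neq1.
  rewrite ger0_norm; last by rewrite -ler0c -normE.
  by rewrite -ltcR -normE lt_neqAle chi_neq1 norm_chi_le1.
have [Phi [cptp [cov err]]] :=
  conversion_error repU psi1 phi1 N (Num.truncn (r * N%:R)) sub.
exists Phi; split=> //; split=> //; apply: (le_trans err).
rewrite rmorph_sum /=; apply: ler_sum => g _.
by rewrite normE rmorphXn.
Qed.

Theorem theorem2 (R : realType) (gT : finGroupType) (d : nat)
  (U : gT -> 'M[R[i]]_d) (psi phi : 'cV[R[i]]_d) :
  is_proj_unitary_rep U ->
  is_pure_state psi -> is_pure_state phi ->
  G0 U psi `<=` G0 U phi ->
  R_ap U psi phi =
    (if `[< SymG U psi `<=` SymG U phi >] then +oo else 0)%E.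
Proof.
move=> repU psi1 phi1; rewrite -!SymG_G0 // => sub; rewrite asboolT //.
(* The supremum is infinite because it dominates every positive real, each of which is an achievable
   rate. *)
apply/eqyP => r r0; apply: ereal_sup_ubound; exists r => //.
split; first exact: ltW.
exact: achievable_all.
Qed.
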